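(* Let $G_n$ be $\mathrm{Sp}_{2n}(F)$ or an even orthogonal group $\mathrm O(W_n)$. (1) If $T$ is a raising operator applicable on $\psi\in\Psi(G_n)$, then $T(\psi)\gneq_A\psi$. In particular, if $\psi\ge_O\psi'$, then $\psi\ge_A\psi'$. (2) Let $\pi$ be an irreducible representation of $G_n$ of Arthur type. Then $\psi^{max}(\pi)$ and $\psi^{min}(\pi)$ are the unique elements of $\Psi(\pi)$ satisfying $$\psi^{max}(\pi)\ge_A\psi\ge_A\psi^{min}(\pi)$$ for all $\psi\in\Psi(\pi)$.
   Context: $F$ is a non-Archimedean local field of characteristic $0$; $W_n$ is a nondegenerate quadratic space over $F$ of dimension $2n$ and discriminant $d$ ($\mathrm O(W_n)$ may or may not be quasi-split); $\chi_W$ is the character attached to $F(\sqrt d)/F$. $\rho$ denotes an irreducible unitary supercuspidal representation of some $\mathrm{GL}_d(F)$, identified with a bounded irreducible $d$-dimensional representation of the Weil group $W_F$; $S_a$ is the $a$-dimensional irreducible representation of $\mathrm{SL}_2(\mathbb C)$. $\Psi(G_n)$ is the set of isomorphism classes of $N$-dimensional orthogonal representations $\psi=\bigoplus_i\rho_i\otimes S_{a_i}\otimes S_{b_i}$ of $W_F\times\mathrm{SL}_2(\mathbb C)\times\mathrm{SL}_2(\mathbb C)$, with $N=2n+1$ and trivial determinant if $G_n=\mathrm{Sp}_{2n}(F)$, and $N=2n$ and determinant $\chi_W$ if $G_n=\mathrm O(W_n)$. $\Pi_\psi$ is the local Arthur packet (Arthur, Mœglin, Mœglin–Renard); $\Psi(\pi)=\{\psi\in\Psi(G_n)\mid\pi\in\Pi_\psi\}$;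 $\pi$ is of Arthur type if $\Psi(\pi)\ne\emptyset$. A summand is of good parity if it is self-dual and orthogonal. Order $\ge_O$: write $\langle A,B\rangle_\rho=\rho\otimes S_{A+B+1}\otimes S_{A-B+1}$ ($\langle A,A+1\rangle_\rho=0$). A raising operator $T$ replaces $\psi$ by a different parameter $T(\psi)$ obtained by one of the following moves on summands of good parity (''applicable'' means that the move can be performed): (i) replace $\langle A_j,B_i\rangle_\rho+\langle A_i,B_j\rangle_\rho$ by $\langle A_i,B_i\rangle_\rho+\langle A_j,B_j\rangle_\rho$, where $A_j>A_i$, $B_j>B_i$, $A_i\ge B_j-1$; (ii) replace $\langle A_i,B_i\rangle_\rho+\langle A_j,B_j\rangle_\rho$ by $\langle A_j,B_i\rangle_\rho+\langle A_i,B_j\rangle_\rho$, where $A_j>A_i$, $-B_j>-B_i$, $A_i\ge-B_j-1$ (second summand omitted if $A_i=-B_j-1$); (iii) replace $\langle A_k,-\frac12\rangle_\rho$ by $\langle A_k,\frac12\rangle_\rho$. $\psi_1\ge_O\psi_2$ means $\psi_1=\psi_2$ or $\psi_1=T_r\circ\cdots\circ T_1(\psi_2)$ for raising operators $T_i$. For $\pi$ of Arthur type, $\Psi(\pi)$ has a unique maximal element $\psi^{max}(\pi)$ and a unique minimal element $\psi^{min}(\pi)$ for $\ge_O$. Preorder $\ge_A$: for $\psi=\bigoplus_{i=1}^r\rho_i\otimes S_{a_i}\otimes S_{b_i}$ with $d_i=\dim\rho_i$, let $\underline p^A(\psi)=[b_1^{a_1d_1},\dots,b_r^{a_rd_r}]$,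 a partition of $N$. $\psi_1\ge_A\psi_2$ means $\underline p^A(\psi_1)\le\underline p^A(\psi_2)$ in the dominance order; $\gneq_A$ denotes the strict relation ($\underline p^A(\psi_1)<\underline p^A(\psi_2)$). *)

(* Defs.v *)
From HB Require Import structures.
From Stdlib Require Export Relation_Operators.
From mathcomp Require Export all_boot all_order all_algebra finmap multiset.
From mathcomp Require Export boolp classical_sets reals.
From mathcomp Require Export complex mxtens.

Set Implicit Arguments.
Unset Strict Implicit.
Unset Printing Implicit Defensive.
Import Order.TTheory GRing.Theory Num.Theory.

Local Open Scope classical_set_scope.
Local Open Scope ring_scope.

(** * Non-Archimedean local fields of characteristic 0 *)

(* [x] lies in the [k]-th power of the maximal ideal for the valuation [v];
   the value [v 0] is irrelevant. *)
Definition val_ge (F : fieldType) (v : F -> int) (k : int) (x : F) : Prop :=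
  x = 0 \/ (k <= v x)%R.

Record local_field := LocalField {
  lf_sort :> fieldType;
  lf_val : lf_sort -> int;
  (* a set of representatives of the residue field *)
  lf_res : seq lf_sort;
  lf_char0 : [pchar lf_sort] =i pred0;
  lf_valM : forall x y, x != 0 -> y != 0 ->
    lf_val (x * y) = lf_val x + lf_val y;
  lf_valD : forall k x y, val_ge lf_val k x -> val_ge lf_val k y ->
    val_ge lf_val k (x + y);
  lf_uniformizer : exists2 p, p != 0 & lf_val p = 1;
  lf_complete : forall u : nat -> lf_sort,
    (forall k, exists N, forall i j, (N <= i)%N -> (N <= j)%N ->
       val_ge lf_val k (u i - u j)) ->
    exists l, forall k, exists N, forall i, (N <= i)%N ->
      val_ge lf_val k (u i - l);
  lf_res_uniq : uniq lf_res;
  lf_res_int : forall r, r \in lf_res -> val_ge lf_val 0 r;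
  lf_resP : forall x, val_ge lf_val 0 x ->
    exists! r, r \in lf_res /\ val_ge lf_val 1 (x - r)
}.

Record algebraic_closure (F : local_field) := AlgebraicClosure {
  ac_sort :> closedFieldType;
  ac_emb : {rmorphism F -> ac_sort};
  ac_algebraic : forall x : ac_sort, algebraicOver ac_emb x
}.

Section WeilGroup.
Variables (F : local_field) (K : algebraic_closure F).

(* The valuation ring of K is the integral closure of that of F. *)
Definition ac_int (x : K) : Prop :=
  exists p : {poly F},
    [/\ p \is monic, forall i, val_ge (@lf_val F) 0 p`_i
      & root (map_poly (ac_emb K) p) x].

Definition ac_max (x : K) : Prop := ac_int x /\ (x = 0 \/ ~ ac_int x^-1).

Definition galois_aut (w : K -> K) : Prop :=
  [/\ zmod_morphism w, monoid_morphism w, bijective w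
    & forall x : F, w (ac_emb K x) = ac_emb K x].

Definition residue_card : nat := size (lf_res F).

(* Automorphisms inducing an integral power of x |-> x^q on the residue
   field of K; the second alternative is the power -m. *)
Definition weil (w : K -> K) : Prop :=
  galois_aut w /\
  exists m : nat,
    (forall x, ac_int x -> ac_max (w x - x ^+ (residue_card ^ m))) \/
    (forall x, ac_int x -> ac_max (w x ^+ (residue_card ^ m) - x)).

Definition inertia (w : K -> K) : Prop :=
  galois_aut w /\ forall x, ac_int x -> ac_max (w x - x).

End WeilGroup.

(** * Representations of the Weil group *)

Section WeilRep.
Variables (R : realType) (F : local_field) (K : algebraic_closure F).

(* Continuous finite-dimensional complex representations.  Only the values of
   [wr_act] on the Weil group matter.  A basis of neighbourhoods of [w] in the
   Weil group is given by the sets of [w \o t], with [t] in the subgroup of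
   the inertia group fixing a finite set [s]. *)
Record weil_rep := WeilRep {
  wr_dim : nat;
  wr_act : (K -> K) -> 'M[R[i]]_wr_dim;
  wr_act1 : wr_act id = 1%:M;
  wr_actM : forall w1 w2, weil w1 -> weil w2 ->
    wr_act (w1 \o w2) = wr_act w1 *m wr_act w2;
  wr_cont : forall w, weil w -> forall e : R[i], 0 < e ->
    exists s : seq K, forall t, inertia t ->
      (forall x, x \in s -> t x = x) ->
      forall i j, `|wr_act (w \o t) i j - wr_act w i j| < e
}.

Definition wr_iso (r r' : weil_rep) : Prop :=
  exists (P : 'M[R[i]]_(wr_dim r, wr_dim r'))
         (Q : 'M[R[i]]_(wr_dim r', wr_dim r)),
    [/\ P *m Q = 1%:M, Q *m P = 1%:M
      & forall w, weil w -> wr_act r w *m P = P *m wr_act r' w].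

Definition wr_irreducible (r : weil_rep) : Prop :=
  (0 < wr_dim r)%N /\
  forall U : 'M[R[i]]_(wr_dim r),
    (forall w, weil w -> stablemx U (wr_act r w)) -> U = 0 \/ row_full U.

Definition wr_bounded (r : weil_rep) : Prop :=
  exists M : R[i], forall w, weil w -> forall i j, `|wr_act r w i j| <= M.

(* Isomorphism classes of bounded irreducible representations of W_F, i.e. of
   irreducible unitary supercuspidal representations of the GL_d(F). *)
Definition irrW : Type :=
  {c : set weil_rep |
    exists2 r, wr_irreducible r /\ wr_bounded r & c = [set r' | wr_iso r r']}.

Definition irrW_repr (rho : irrW) : weil_rep := s2val (cid2 (svalP rho)).

(* Value at [g] of S_a = Sym^(a-1), on the basis x^i y^(a-1-i), 0 <= i < a,
   dehomogenized at y = 1. *)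
Definition symrep (a : nat) (g : 'M[R[i]]_2) : 'M[R[i]]_a :=
  \matrix_(i < a, j < a)
    (((g 0 0 *: 'X + (g 0 1)%:P) ^+ i
      * (g 1 0 *: 'X + (g 1 1)%:P) ^+ (a.-1 - i))`_j).

(** * Parameters *)

(* (rho, a, b) stands for rho (x) S_a (x) S_b. *)
Definition summand : choiceType := ({classic irrW} * nat * nat)%type.

Definition s_rho (x : summand) : irrW := x.1.1.
Definition s_a (x : summand) : nat := x.1.2.
Definition s_b (x : summand) : nat := x.2.
Definition rho_dim (rho : irrW) : nat := wr_dim (irrW_repr rho).
Definition s_dim (x : summand) : nat := (rho_dim (s_rho x) * s_a x * s_b x)%N.

Definition s_act (x : summand) (w : K -> K) (g h : 'M[R[i]]_2)
    : 'M[R[i]]_(s_dim x) :=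
  (wr_act (irrW_repr (s_rho x)) w *t symrep (s_a x) g) *t symrep (s_b x) h.

Fixpoint rep_dim (s : seq summand) : nat :=
  if s is x :: s' then (s_dim x + rep_dim s')%N else 0%N.

(* The direct sum of the summands in [s], as a representation of
   W_F x SL_2(C) x SL_2(C). *)
Fixpoint rep_act (s : seq summand) (w : K -> K) (g h : 'M[R[i]]_2)
    : 'M[R[i]]_(rep_dim s) :=
  match s return 'M[R[i]]_(rep_dim s) with
  | [::] => 0
  | x :: s' => block_mx (s_act x w g h) 0 0 (rep_act s' w g h)
  end.

Definition orthogonal_rep (s : seq summand) : Prop :=
  exists B : 'M[R[i]]_(rep_dim s),
    [/\ B^T = B, B \in unitmx
      & forall w g h, weil w -> \det g = 1 -> \det h = 1 ->
          (rep_act s w g h)^T *m B *m rep_act s w g h = B].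

(* Isomorphism classes of representations of the form
   (+)_i rho_i (x) S_(a_i) (x) S_(b_i), encoded by their constituents counted
   with multiplicity. *)
Definition param : Type := {mset summand}%mset.
Identity Coercion multiset_of_param : param >-> multiset_of.

(** * The groups Sp_2n(F) and O(W_n) *)

(* [O_group Q] is O(W_n) for the quadratic space W_n = F^2n with Gram
   matrix [Q]. *)
Inductive classical_group (n : nat) : Type :=
| Sp_group
| O_group (Q : 'M[F]_(n + n)) of Q^T = Q & Q \in unitmx.

Definition gram (n : nat) (G : classical_group n) : 'M[F]_(n + n) :=
  match G with
  | Sp_group => block_mx 0 1%:M (- 1%:M) 0
  | O_group Q _ _ => Q
  end.

Definition in_group (n : nat) (G : classical_group n) (g : 'M[F]_(n + n)) :=
  g^T *m gram G *m g = gram G.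

(* Normalized so that a sum of hyperbolic planes has discriminant 1. *)
Definition discriminant (n : nat) (Q : 'M[F]_(n + n)) : F := (-1) ^+ n * \det Q.

(* The character of W_F attached to F(sqrt d)/F. *)
Definition chi (d : F) (w : K -> K) : R[i] :=
  if `[< exists2 x : K, x ^+ 2 = ac_emb K d & w x = x >] then 1 else -1.

Definition is_param (n : nat) (G : classical_group n) (psi : param) : Prop :=
  [/\ forall x, x \in psi -> (0 < s_a x)%N /\ (0 < s_b x)%N,
      orthogonal_rep psi
    & match G with
      | Sp_group =>
          rep_dim psi = (n + n).+1 /\
          forall w g h, weil w -> \det g = 1 -> \det h = 1 ->
            \det (rep_act psi w g h) = 1
      | O_group Q _ _ =>
          rep_dim psi = (n + n)%N /\
          forall w g h, weil w -> \det g = 1 -> \det h = 1 ->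
            \det (rep_act psi w g h) = chi (discriminant Q) w
      end].

(** * Irreducible smooth representations of G_n *)

(* Only the values of [gr_act] on the group matter. *)
Record group_rep (n : nat) (G : classical_group n) := GroupRep {
  gr_space : lmodType R[i];
  gr_act : 'M[F]_(n + n) -> {linear gr_space -> gr_space};
  gr_act1 : forall v, gr_act 1%:M v = v;
  gr_actM : forall g h, in_group G g -> in_group G h ->
    forall v, gr_act (g *m h) v = gr_act g (gr_act h v);
  gr_smooth : forall v, exists k : int, forall g, in_group G g ->
    (forall i j, val_ge (@lf_val F) k (g i j - (1%:M : 'M[F]_(n + n)) i j)) ->
    gr_act g v = v
}.

Definition gr_irreducible n (G : classical_group n) (V : group_rep G) : Prop :=
  (exists v : gr_space V, v != 0) /\
  forall U : set (gr_space V),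
    U 0 -> (forall (c : R[i]) u v, U u -> U v -> U (c *: u + v)) ->
    (forall g, in_group G g -> forall u, U u -> U (gr_act V g u)) ->
    U = [set 0] \/ U = setT.

Definition gr_iso n (G : classical_group n) (V V' : group_rep G) : Prop :=
  exists f : {linear gr_space V -> gr_space V'},
    bijective f /\
    forall g, in_group G g -> forall v, f (gr_act V g v) = gr_act V' g (f v).

(** * The order >=_O *)

(* <A, B>_rho is a genuine summand: A + B + 1 and A - B + 1 are positive
   integers. *)
Definition genuine (A B : rat) : bool :=
  (A + B \is a Num.nat) && (A - B \is a Num.nat).

(* <A, B>_rho, with <A, A + 1>_rho = 0. *)
Definition bracket (rho : irrW) (A B : rat) : param :=
  if B == A + 1 then mset0
  else [mset ((rho, Num.truncn (A + B + 1), Num.truncn (A - B + 1))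
              : summand)]%mset.

Definition good_parity (psi : param) : Prop :=
  forall x, x \in psi -> orthogonal_rep [:: x].

(* [raise psi psi'] : psi' = T psi for a raising operator T applicable on psi.
   The unchanged summands are collected in [phi]. *)
Inductive raise : param -> param -> Prop :=
| Raise_i (phi : param) rho Ai Bi Aj Bj of
    genuine Aj Bi & genuine Ai Bj || (Ai == Bj - 1)
  & genuine Ai Bi & genuine Aj Bj
  & good_parity (bracket rho Aj Bi) & good_parity (bracket rho Ai Bj)
  & Ai < Aj & Bi < Bj & Bj - 1 <= Ai :
    raise (phi `+` (bracket rho Aj Bi `+` bracket rho Ai Bj))%mset
          (phi `+` (bracket rho Ai Bi `+` bracket rho Aj Bj))%mset
| Raise_ii (phi : param) rho Ai Bi Aj Bj of
    genuine Ai Bi & genuine Aj Bj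
  & genuine Aj Bi & genuine Ai Bj || (Ai == - Bj - 1)
  & good_parity (bracket rho Ai Bi) & good_parity (bracket rho Aj Bj)
  & Ai < Aj & - Bi < - Bj & - Bj - 1 <= Ai :
    raise (phi `+` (bracket rho Ai Bi `+` bracket rho Aj Bj))%mset
          (phi `+` (bracket rho Aj Bi `+`
                    (if Ai == - Bj - 1 then mset0 else bracket rho Ai Bj)))%mset
| Raise_iii (phi : param) rho Ak of
    genuine Ak (- 2^-1) & good_parity (bracket rho Ak (- 2^-1)) :
    raise (phi `+` bracket rho Ak (- 2^-1))%mset
          (phi `+` bracket rho Ak (2^-1))%mset.

Definition geO (psi1 psi2 : param) : Prop := clos_refl_trans param raise psi2 psi1.

(** * The preorder >=_A *)

(* The partition [b_1^(a_1 d_1), ..., b_r^(a_r d_r)], in decreasing order. *)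
Definition pA (psi : param) : seq nat :=
  sort geq (flatten [seq nseq (s_a x * rho_dim (s_rho x)) (s_b x) | x <- psi]).

Definition geA (psi1 psi2 : param) : Prop :=
  forall k, (sumn (take k (pA psi1)) <= sumn (take k (pA psi2)))%N.

Definition gtA (psi1 psi2 : param) : Prop :=
  geA psi1 psi2 /\ pA psi1 <> pA psi2.

(** * Packets *)

(* An assignment psi |-> Pi_psi of sets of isomorphism classes of irreducible
   representations of G_n to parameters. *)
Record packets n (G : classical_group n) := Packets {
  in_packet :> param -> group_rep G -> Prop;
  packet_irr : forall psi pi, in_packet psi pi -> gr_irreducible pi;
  packet_iso : forall psi pi pi', gr_iso pi pi' ->
    in_packet psi pi -> in_packet psi pi'
}.

(* The set Psi(pi). *)
Definition Psi_of n (G : classical_group n) (Pi : packets G) (pi : group_rep G)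
    : set param :=
  [set psi | is_param G psi /\ Pi psi pi].

Definition maximalO (S : set param) (psi : param) : Prop :=
  S psi /\ forall psi', S psi' -> geO psi' psi -> psi' = psi.

Definition minimalO (S : set param) (psi : param) : Prop :=
  S psi /\ forall psi', S psi' -> geO psi psi' -> psi' = psi.

End WeilRep.

Arguments param R {F} K.
Arguments packets R {F} K {n} G.
Arguments group_rep R {F n} G.
Arguments is_param R {F} K {n} G psi.

(* Main.v *)
(** The dominance order is detected by the convex functions [(b - c)_+]: a
    parameter is larger for [>=_A] iff its excess, the sum of
    [a * dim rho * (b - c)_+] over its summands, is smaller for every [c].  The
    excess is additive over summands, and the three raising operators are
    instances of one exchange
      (a + t, b) + (a + s, b + s + t)  |->  (a, b + t) + (a + s + t, b + s)
    of pairs of dimensions, under which convexity makes it decrease, strictly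
    at [c = b + s + t - 1].  Since the excesses of parameters of a fixed
    dimension are bounded, every element of Psi(pi) lies below a maximal element
    and above a minimal one, hence between psi^max and psi^min. *)

From mathcomp Require Import lra zify.
Require Import Defs.

Set Implicit Arguments.
Unset Strict Implicit.
Unset Printing Implicit Defensive.
Import Order.TTheory GRing.Theory Num.Theory.

Local Open Scope classical_set_scope.
Local Open Scope ring_scope.

(** * Partial sums of a decreasing sequence and truncated sums *)

(** Entrywise [b <= c + (b - c)] with truncated subtraction. For decreasing [s] this is a Legendre
    duality: equality holds at some [c] for each [k], and at some [k] for each [c]. *)
Lemma sumn_take_le (k c : nat) (s : seq nat) :
  (sumn (take k s) <= k * c + \sum_(b <- s) (b - c))%N.
Proof.
elim: s k => [|x s IHs] [|k] //=; rewrite big_cons.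
by have := IHs k; lia.
Qed.

Lemma sumn_cat_threshold (c : nat) (s1 s2 : seq nat) :
  all (leq c) s1 -> all (geq c) s2 ->
  sumn s1 = (size s1 * c + \sum_(b <- s1 ++ s2) (b - c))%N.
Proof.
move=> + s2_le; elim: s1 => [_|x s1 IHs1 /= /andP[x_ge /IHs1 ->]].
  rewrite /= big_seq big1// => b b_s2.
  by apply/eqP; rewrite subn_eq0; apply: (allP s2_le).
by rewrite big_cons; lia.
Qed.

Lemma sumn_take_threshold (k : nat) (s : seq nat) : sorted geq s ->
  exists c, sumn (take k s) = (k * c + \sum_(b <- s) (b - c))%N.
Proof.
have geq_trans : transitive geq by move=> x y z; rewrite /geq /=; lia.
rewrite sorted_pairwise// => s_geq.
case: (ltnP k (size s)) => [k_lt|k_ge]; last first.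
  exists 0%N; rewrite take_oversize// muln0 add0n sumnE.
  by apply: eq_bigr => b _; rewrite subn0.
(* The threshold is the first entry left out. *)
exists (nth 0%N s k); move: s_geq.
rewrite -{1}(cat_take_drop k s) (drop_nth 0%N k_lt) pairwise_cat.
rewrite allrel_consr /= => /and3P[/andP[s1_ge _] _ /andP[s2_le _]].
rewrite (@sumn_cat_threshold (nth 0%N s k) _ (drop k s)) ?cat_take_drop//.
  by rewrite size_takel// ltnW.
by rewrite (drop_nth 0%N k_lt) /= leqnn.
Qed.

(** The witness [k] counts the entries above [c]. *)
Lemma sum_excess_take (c : nat) (s : seq nat) : sorted geq s ->
  exists k, sumn (take k s) = (k * c + \sum_(b <- s) (b - c))%N.
Proof.
have geq_trans : transitive geq by move=> x y z; rewrite /geq /=; lia.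
elim: s => [_|x s IHs s_sorted]; first by exists 0%N; rewrite big_nil.
case: (ltnP c x) => [c_lt|x_le].
  have [k eq_k] := IHs (path_sorted s_sorted).
  by exists k.+1; rewrite /= eq_k big_cons; lia.
exists 0%N; rewrite take0 -[LHS]/(sumn [::]).
rewrite (@sumn_cat_threshold c [::] (x :: s))//= x_le /=.
apply/allP => b b_s; apply: leq_trans x_le.
by have /allP := order_path_min geq_trans s_sorted; apply.
Qed.

(** * The exchange inequality *)

(* With [f y = (y - c)_+], the gain is [a] times a second difference of the
   convex function [f], plus the Jensen inequality
   [(s + t) * f (b + s) <= s * f (b + s + t) + t * f b]. *)
Lemma exchange_leq (a b s t c : nat) :
  (a * (b + t - c) + (a + s + t) * (b + s - c)
   <= (a + t) * (b - c) + (a + s) * (b + s + t - c))%N.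
Proof.
have conv : (b + t - c + (b + s - c) <= b - c + (b + s + t - c))%N by lia.
have jensen : ((s + t) * (b + s - c) <= t * (b - c) + s * (b + s + t - c))%N.
  case: (leqP (b + s) c) => [bs_le|c_lt]; first by rewrite (eqP bs_le) muln0.
  case: (leqP c b) => [c_le|b_lt].
    have [y ->] : exists y, b = (c + y)%N by exists (b - c)%N; lia.
    have -> : (c + y + s - c = y + s)%N by lia.
    have -> : (c + y + s + t - c = y + s + t)%N by lia.
    have -> : (c + y - c = y)%N by lia.
    nia.
  (* Now [b < c < b + s], and the claim reduces to [t * y <= t * s]. *)
  have -> : (b - c = 0)%N by lia.
  have [y [-> y_le]] : exists y, (b + s = c + y)%N /\ (y <= s)%N.
    by exists (b + s - c)%N; lia.
  have -> : (c + y - c = y)%N by lia.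
  have -> : (c + y + t - c = y + t)%N by lia.
  nia.
have := leq_mul (leqnn a) conv.
nia.
Qed.

(** At this [c] only [b + s + t] survives truncation, which leaves a gap of [a + s]. *)
Lemma exchange_ltn (a b s t : nat) : (0 < s)%N -> (0 < t)%N ->
  let c := (b + s + t).-1 in
  (a * (b + t - c) + (a + s + t) * (b + s - c)
   < (a + t) * (b - c) + (a + s) * (b + s + t - c))%N.
Proof.
move=> s_gt0 t_gt0 /=.
have -> : (b + t - (b + s + t).-1 = 0)%N by lia.
have -> : (b + s - (b + s + t).-1 = 0)%N by lia.
have -> : (b + s + t - (b + s + t).-1 = 1)%N by lia.
lia.
Qed.

(** Each proper step up within [S] lowers [f], so the climb from [x] stops. *)
Lemma exists_maximal_above (T : Type) (S : T -> Prop) (r : T -> T -> Prop)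
    (f : T -> nat) (x : T) :
  (forall y, r y y) -> (forall y z w, r y z -> r z w -> r y w) ->
  (forall y z, S y -> S z -> r y z -> y <> z -> (f z < f y)%N) ->
  S x -> exists2 m, r x m & S m /\ forall y, S y -> r m y -> y = m.
Proof.
move=> r_refl r_trans f_lt; have [n] := ubnP (f x); elim: n x => // n IHn x.
rewrite ltnS => fx_le Sx.
have [max_x|] := pselect (forall y, S y -> r x y -> y = x); first by exists x.
move=> /existsNP[y /not_implyP[Sy /not_implyP[rxy /nesym xy]]].
have [|m rym max_m] := IHn y _ Sy; last by exists m; first exact: r_trans rym.
exact: leq_trans (f_lt _ _ Sx Sy rxy xy) fx_le.
Qed.

(** * Excess of a parameter and the preorder *)

Section Excess.
Variables (R : realType) (F : local_field) (K : algebraic_closure F).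
Implicit Types (psi phi : param R K) (rho : irrW R K).

Lemma rho_dim_gt0 rho : (0 < rho_dim rho)%N.
Proof. by rewrite /rho_dim /irrW_repr; case: cid2 => /= r [[]]. Qed.

Definition s_mult (x : summand R K) : nat := (s_a x * rho_dim (s_rho x))%N.

Definition excess (c : nat) psi : nat :=
  \sum_(x <- psi) s_mult x * (s_b x - c).

Lemma excess_msetD c psi phi :
  excess c (psi `+` phi)%mset = (excess c psi + excess c phi)%N.
Proof.
rewrite /excess -big_cat; apply: perm_big.
by apply/allP => x _ /=; rewrite count_cat !count_mem_mset msetE2.
Qed.

(** A zero bracket is the case [b = 0], where the right-hand side vanishes too. *)
Lemma excess_bracket c rho (A B : rat) (a b : nat) :
  A + B + 1 = a%:R -> A - B + 1 = b%:R ->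
  excess c (bracket rho A B) = (a * rho_dim rho * (b - c))%N.
Proof.
move=> eq_a eq_b; rewrite /bracket.
have -> : (B == A + 1) = (b == 0)%N.
  by rewrite -(eqr_nat rat) -eq_b; apply/eqP/eqP; lra.
case: eqP => [->|_]; first by rewrite /excess enum_mset0 big_nil muln0.
rewrite /excess enum_msetn big_seq1 /s_mult /s_a /s_b /s_rho /=.
by rewrite eq_a eq_b !natrK.
Qed.

Lemma sum_pA c psi : (\sum_(b <- pA psi) (b - c) = excess c psi)%N.
Proof.
rewrite /pA (perm_big _ (permEl (perm_sort _ _))) big_flatten big_map.
apply: eq_bigr => x _.
by rewrite big_nseq iter_addn_0 mulnC.
Qed.

Lemma pA_sorted psi : sorted geq (pA psi).
Proof. by apply: sort_sorted => x y; rewrite /geq /= leq_total. Qed.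

(** Each direction uses the duality as an equality for one parameter and as an inequality for the
    other. *)
Lemma geA_excess psi psi' :
  geA psi psi' <-> forall c, (excess c psi <= excess c psi')%N.
Proof.
split=> [le_psi c|le_exc k].
  have [k] := sum_excess_take c (pA_sorted psi).
  have := sumn_take_le k c (pA psi'); have := le_psi k.
  by rewrite !sum_pA; lia.
have [c] := sumn_take_threshold k (pA_sorted psi').
have := sumn_take_le k c (pA psi); have := le_exc c.
by rewrite !sum_pA; lia.
Qed.

(** * Strict decrease of the excess under raising operators *)

Definition lt_excess psi psi' : Prop :=
  (forall c, (excess c psi <= excess c psi')%N) /\
  exists c, (excess c psi < excess c psi')%N.

Lemma lt_excess_gtA psi psi' : lt_excess psi psi' -> gtA psi psi'.
Proof.
move=> [/geA_excess le_psi [c lt_c]]; split=> // eq_pA.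
by move: lt_c; rewrite -!sum_pA eq_pA ltnn.
Qed.

(** The part [phi] cancels by additivity, and the common factor [rho_dim rho] is positive. *)
Lemma lt_excess_exchange phi psi psi' rho (a b s t : nat) :
  (0 < s)%N -> (0 < t)%N ->
  (forall c, excess c psi =
    ((a + t) * rho_dim rho * (b - c)
     + (a + s) * rho_dim rho * (b + s + t - c))%N) ->
  (forall c, excess c psi' =
    (a * rho_dim rho * (b + t - c)
     + (a + s + t) * rho_dim rho * (b + s - c))%N) ->
  lt_excess (phi `+` psi')%mset (phi `+` psi)%mset.
Proof.
move=> s_gt0 t_gt0 exc_psi exc_psi'.
split=> [c|].
  rewrite !excess_msetD leq_add2l exc_psi exc_psi'.
  rewrite !(mulnAC _ (rho_dim rho)) -!mulnDl leq_mul2r.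
  by rewrite exchange_leq orbT.
exists (b + s + t).-1.
rewrite !excess_msetD ltn_add2l exc_psi exc_psi'.
rewrite !(mulnAC _ (rho_dim rho)) -!mulnDl ltn_mul2r rho_dim_gt0.
exact: exchange_ltn.
Qed.

Lemma natr_sub_pos (x y : rat) (p q : nat) :
  x = p%:R -> y = q%:R -> x < y -> exists2 s, (0 < s)%N & y = x + s%:R.
Proof.
move=> -> ->; rewrite ltr_nat => pq; exists (q - p)%N; first by rewrite subn_gt0.
by rewrite natrB ?(ltnW pq)// addrC subrK.
Qed.

Lemma genuineP (A B : rat) : genuine A B ->
  exists p q : nat, A + B = p%:R /\ A - B = q%:R.
Proof. by move=> /andP[/natrP[p ->] /natrP[q ->]]; exists p, q. Qed.

(* The three moves are the same exchange: [a] and [b] are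
   [A_i + B_i + 1] and [A_i - B_j + 1] in (i), [A_i + B_j + 1] and
   [A_i - B_i + 1] in (ii), and [0] and [0] in (iii).  A zero bracket in (i)
   is [b = 0], an omitted summand in (ii) is [a = 0]. *)
Lemma raise_lt_excess psi psi' : raise psi psi' -> lt_excess psi' psi.
Proof.
case=> [phi rho Ai Bi Aj Bj|phi rho Ai Bi Aj Bj|phi rho A].
- move=> /genuineP[p1 [q1 [Ep1 Eq1]]] _ /genuineP[p2 [q2 [Ep2 Eq2]]].
  move=> /genuineP[p3 [q3 [Ep3 Eq3]]] _ _ ltA ltB leA.
  have [|s s_gt0 Es] := @natr_sub_pos (Ai + Bi) (Aj + Bi) _ _ Ep2 Ep1.
    by rewrite ltrD2r.
  have [|t t_gt0 Et] := @natr_sub_pos (Aj + Bi) (Aj + Bj) _ _ Ep1 Ep3.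
    by rewrite ltrD2l.
  (* Since [t = Bj - Bi], this is the hypothesis [Bj - 1 <= Ai]; it makes [q2.+1 - t] an honest
     difference. *)
  have t_le : (t <= q2.+1)%N.
    by rewrite -(ler_nat rat) -addn1 natrD -Eq2; lra.
  have Eb : (q2.+1 - t)%:R = q2%:R + 1 - t%:R :> rat.
    by rewrite natrB// -addn1 natrD.
  apply: (@lt_excess_exchange phi _ _ rho p2.+1 (q2.+1 - t) s t) => // c;
    rewrite excess_msetD; [rewrite addnC|]; congr (_ + _)%N;
    apply: excess_bracket;
    rewrite ?natrD ?Eb -?[p2.+1]addn1 ?natrD -?Ep2 -?Eq2; lra.
- move=> /genuineP[p1 [q1 [Ep1 Eq1]]] /genuineP[p2 [q2 [Ep2 Eq2]]].
  move=> /genuineP[p3 [q3 [Ep3 Eq3]]] _ _ _ ltA ltB leA.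
  have [|s s_gt0 Es] := @natr_sub_pos (Ai + Bi) (Aj + Bi) _ _ Ep1 Ep3.
    by rewrite ltrD2r.
  have [|t t_gt0 Et] := @natr_sub_pos (Aj - Bi) (Aj - Bj) _ _ Eq3 Eq2.
    by rewrite ltrD2l.
  have t_le : (t <= p1.+1)%N.
    by rewrite -(ler_nat rat) -addn1 natrD -Ep1; lra.
  have Ea : (p1.+1 - t)%:R = p1%:R + 1 - t%:R :> rat.
    by rewrite natrB// -addn1 natrD.
  apply: (@lt_excess_exchange phi _ _ rho (p1.+1 - t) q1.+1 s t) => // c;
    rewrite excess_msetD; last first.
    rewrite addnC; congr (_ + _)%N; last first.
      by apply: excess_bracket;
        rewrite ?natrD ?Ea -?[q1.+1]addn1 ?natrD -?Ep1 -?Eq1; lra.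
    case: eqP => [eqA|_].
      rewrite /excess enum_mset0 big_nil.
      suff -> : (p1.+1 - t = 0)%N by rewrite !mul0n.
      by apply/eqP; rewrite -(eqr_nat rat) Ea -Ep1; apply/eqP; lra.
    by apply: excess_bracket;
      rewrite ?natrD ?Ea -?[q1.+1]addn1 ?natrD -?Ep1 -?Eq1; lra.
  congr (_ + _)%N;
    by apply: excess_bracket;
      rewrite ?natrD ?Ea -?[q1.+1]addn1 ?natrD -?Ep1 -?Eq1; lra.
move=> /genuineP[p [q [Ep Eq]]] _.
(* Here [p = A - 1/2]; one of the two terms vanishes on each side. *)
apply: (@lt_excess_exchange phi _ _ rho 0 0 p.+1 1) => // c.
  by rewrite muln0 add0n; apply: excess_bracket;
    rewrite ?natrD -?[p.+1]addn1 ?natrD -?Ep; lra.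
by rewrite mul0n add0n; apply: excess_bracket;
  rewrite ?natrD -?[p.+1]addn1 ?natrD -?Ep; lra.
Qed.

Lemma geO_lt_excess psi psi' :
  geO psi psi' -> psi = psi' \/ lt_excess psi psi'.
Proof.
elim=> [x y /raise_lt_excess ?|x|x y z _ IHxy _ IHyz]; [by right|by left|].
case: IHxy => [<-//|[le_yx [c lt_yx]]].
case: IHyz => [->|[le_zy _]]; first by right; split=> //; exists c.
right; split=> [d|]; first exact: leq_trans (le_zy d) _.
by exists c; apply: leq_ltn_trans (le_zy c) _.
Qed.

Lemma geO_geA psi psi' : geO psi psi' -> geA psi psi'.
Proof.
by case/geO_lt_excess => [->|[le_exc _]]; apply/geA_excess.
Qed.

(** Although [geA] is only a preorder, it separates distinct parameters comparable for [geO], as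
    some excess drops strictly. *)
Lemma geO_geA_anti psi psi' : geO psi psi' -> geA psi' psi -> psi = psi'.
Proof.
case/geO_lt_excess => // -[_ [c +]] /geA_excess /(_ c).
by rewrite ltnNge => /negP.
Qed.

(** * Bounded energy and extremal elements *)

Lemma rep_dim_excess psi : rep_dim psi = excess 0 psi.
Proof.
rewrite /excess; elim: (EnumMset.f _) => [|x s IHs]; first by rewrite big_nil.
by rewrite big_cons /= IHs subn0 /s_dim /s_mult (mulnC (rho_dim _)).
Qed.

Lemma excess_le_rep_dim c psi : (excess c psi <= rep_dim psi)%N.
Proof.
by rewrite rep_dim_excess; apply: leq_sum => x _; rewrite leq_mul2l; lia.
Qed.

Lemma excess_rep_dim_eq0 c psi : (rep_dim psi <= c)%N -> excess c psi = 0%N.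
Proof.
rewrite rep_dim_excess => dim_le.
rewrite /excess big_seq big1// => x x_psi; apply/eqP; rewrite muln_eq0 subn_eq0.
rewrite -[_ == _]negbK -implyNb negbK -lt0n; apply/implyP => mult_gt0.
apply: leq_trans dim_le; rewrite /excess (big_rem x)//= subn0.
by apply: leq_trans (leq_addr _ _); rewrite leq_pmull.
Qed.

(* A strictly monotone integer statistic for the order, bounded on the
   parameters of dimension [N]: this makes chains finite in both directions. *)
Definition energy (N : nat) psi : nat := (\sum_(c < N) excess c psi)%N.

Lemma energy_le N psi : (energy N psi <= N * rep_dim psi)%N.
Proof.
have -> : (N * rep_dim psi = \sum_(c < N) rep_dim psi)%N.
  by rewrite sum_nat_const card_ord.
by apply: leq_sum => c _; apply: excess_le_rep_dim.
Qed.

(** Excesses of [psi'] vanish from [N] on, so the strict drop occurs at some [c < N] and is seen by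
    the energy. *)
Lemma geO_energy_lt N psi psi' : rep_dim psi' = N ->
  geO psi psi' -> psi <> psi' -> (energy N psi < energy N psi')%N.
Proof.
move=> dim_psi' /geO_lt_excess[//|[le_exc [c lt_c]] _].
have c_lt : (c < N)%N.
  rewrite ltnNge; apply/negP; rewrite -dim_psi' => /excess_rep_dim_eq0 exc0.
  by rewrite exc0 in lt_c.
rewrite /energy (bigD1 (Ordinal c_lt))//= [ltnRHS](bigD1 (Ordinal c_lt))//=.
by rewrite -addSn leq_add//; apply: leq_sum.
Qed.

Lemma geO_refl psi : geO psi psi.
Proof. exact: rt_refl. Qed.

Lemma geO_trans psi phi psi' : geO psi phi -> geO phi psi' -> geO psi psi'.
Proof. by move=> ? ?; apply: rt_trans; eassumption. Qed.

Lemma exists_maximalO (S : set (param R K)) N psi :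
  (forall phi, S phi -> rep_dim phi = N) -> S psi ->
  exists2 m, maximalO S m & geO m psi.
Proof.
move=> dimS Spsi.
have [||y z Sy Sz|m geO_m max_m] :=
  @exists_maximal_above _ S (fun x y => geO y x) (energy N) psi _ _ _ Spsi.
- exact: geO_refl.
- by move=> y z w zy wz; apply: geO_trans zy.
- by move=> zy /nesym; apply: geO_energy_lt => //; apply: dimS.
- by exists m.
Qed.

Lemma exists_minimalO (S : set (param R K)) N psi :
  (forall phi, S phi -> rep_dim phi = N) -> S psi ->
  exists2 m, minimalO S m & geO psi m.
Proof.
move=> dimS Spsi.
(* The energy is at most [N * N], so truncated subtraction reverses it strictly. *)
have [||y z Sy Sz|m geO_m max_m] :=
  @exists_maximal_above _ S (@geO _ _ K) (fun x => N * N - energy N x)%N psi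
    _ _ _ Spsi.
- exact: geO_refl.
- exact: geO_trans.
- move=> yz nyz; have := geO_energy_lt (dimS _ Sz) yz nyz.
  have := energy_le N z; rewrite (dimS _ Sz); lia.
- by exists m.
Qed.

Lemma Psi_of_rep_dim n (G : classical_group F n) (Pi : packets R K G)
    (pi : group_rep R G) :
  exists N, forall psi, Psi_of Pi pi psi -> rep_dim psi = N.
Proof.
by case: G Pi pi => [|Q Qsym Qunit] Pi pi;
  eexists => psi [[_ _ [dim_psi _]] _]; exact: dim_psi.
Qed.

End Excess.

Theorem theorem7p2 (R : realType) (F : local_field) (K : algebraic_closure F)
    (n : nat) (G : classical_group F n) :

  [/\ forall psi Tpsi : param R K,
        is_param R K G psi -> raise psi Tpsi -> gtA Tpsi psi,
      forall psi psi' : param R K,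
        is_param R K G psi -> is_param R K G psi' -> geO psi psi' -> geA psi psi'
  (* the packets Pi_psi are Pi psi *)
    & forall (Pi : packets R K G) (pi : group_rep R G)
             (psimax psimin : param R K),
        gr_irreducible pi ->
        Psi_of Pi pi !=set0 ->
        unique (maximalO (Psi_of Pi pi)) psimax ->
        unique (minimalO (Psi_of Pi pi)) psimin ->
        unique (fun p : param R K * param R K =>
                  [/\ Psi_of Pi pi p.1, Psi_of Pi pi p.2
                    & forall psi, Psi_of Pi pi psi ->
                        geA p.1 psi /\ geA psi p.2])
               (psimax, psimin)].
Proof.
split.
- by move=> psi Tpsi _ /raise_lt_excess /lt_excess_gtA.
- by move=> psi psi' _ _; apply: geO_geA.
move=> Pi pi psimax psimin _ _ [max_psimax max_uniq] [min_psimin min_uniq].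
have [N dimN] := Psi_of_rep_dim Pi pi.
(* Some maximal element lies above [psi], and uniqueness identifies it with [psimax]. *)
have geO_max psi : Psi_of Pi pi psi -> geO psimax psi.
  by move=> /(exists_maximalO dimN)[m /max_uniq ->].
have geO_min psi : Psi_of Pi pi psi -> geO psi psimin.
  by move=> /(exists_minimalO dimN)[m /min_uniq ->].
split=> [|[q1 q2] [/= Sq1 Sq2 q_bounds]].
  split; [exact: max_psimax.1|exact: min_psimin.1|move=> psi Spsi /=].
  by split; apply: geO_geA; [apply: geO_max|apply: geO_min].
congr pair.
  by apply: geO_geA_anti; [apply: geO_max|apply: (q_bounds _ max_psimax.1).1].
apply/esym/geO_geA_anti; first exact: geO_min.
exact: (q_bounds _ min_psimin.1).2.
Qed.
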